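(* Let $S$ be the set of all odd positive integers and let $G$ be a connected graph. Then $G$ admits an $S$-Hamiltonian cycle if and only if either $G$ is non-bipartite, or $G$ is bipartite with the two sides of its bipartition of equal cardinality.
   Context: All graphs are finite, simple, undirected, without self-loops, non-empty and connected. A graph is bipartite if its vertex set can be partitioned into two non-empty sets such that every edge joins the two sets. A walk of length $k$ is a sequence of vertices $(u_0,\dots,u_k)$ with consecutive vertices adjacent; vertices may repeat. For $S \subseteq \mathbb{N}^+$, an $S$-Hamiltonian cycle of $G$ is a sequence $(v_1,\dots,v_n)$ listing every vertex of $G$ exactly once such that for each $i<n$, and also for the pair $(v_n,v_1)$, the two vertices are joined by a walk in $G$ whose length lies in $S$.
   Formalization: The graph is assumed to have at least one edge, which excludes only the one-vertex graph; that graph is non-bipartite (two non-empty sides are impossible) yet has no odd closed walk, so the equivalence fails for it as stated. *)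

(* Defs.v *)
From mathcomp Require Import all_boot.

Set Implicit Arguments.
Unset Strict Implicit.
Unset Printing Implicit Defensive.

Section SHamiltonian.

Variables (T : finType) (e : rel T).

Definition connected_graph : Prop := forall x y : T, connect e x y.

(* Non-emptiness of a graph.  For a connected graph this excludes only the
   one-vertex and null graphs; the one-vertex graph has no bipartition into two
   non-empty sides and no walk of positive length. *)
Definition has_edge : Prop := exists x y : T, e x y.

Definition is_bipartition (A B : {set T}) : Prop :=
  [/\ A != set0, B != set0, A :|: B = [set: T], [disjoint A & B] &
      forall x y : T,
        e x y -> (x \in A) && (y \in B) || (x \in B) && (y \in A)].

Definition bipartite : Prop := exists A B : {set T}, is_bipartition A B.

(* The walk is u :: p, so its length (number of steps) is size p. *)
Definition walk_joined (S : pred nat) (u v : T) : Prop :=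
  exists p : seq T, [/\ path e u p, last u p = v & S (size p)].

(* As c is duplicate-free, next c maps each item to the following one and the
   last item to the first.  For a one-item c, next c x = x, so a closed walk
   at x with length in S is required. *)
Definition S_hamiltonian_cycle (S : pred nat) (c : seq T) : Prop :=
  [/\ uniq c, forall x : T, x \in c &
      forall x : T, x \in c -> walk_joined S x (next c x)].

End SHamiltonian.

(* Main.v *)
(** A bipartition turns an odd walk into a change of side, so along an
    odd-Hamiltonian cycle the successor map injects each side into the other,
    and the sides are equipotent.  Conversely, two equipotent sides can be
    listed alternately, and a connected graph joins vertices on different sides
    by odd walks only.  In a connected non-bipartite graph every vertex lies on
    an odd closed walk, since otherwise the parity of the walks from it would
    define a bipartition; hence any two vertices are joined by an odd walk and
    every enumeration of the vertices is a suitable cycle. *)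
Require Import Defs.
From mathcomp Require Import all_boot.

Set Implicit Arguments.
Unset Strict Implicit.
Unset Printing Implicit Defensive.

Section Walks.

Variables (T : finType) (e : rel T).

(* The bipartite double cover: reachability in it decides the existence of a
   walk of given parity. *)
Definition double_cover : rel (T * bool) :=
  fun u v => e u.1 v.1 && (v.2 == ~~ u.2).

Lemma double_cover_path (p : seq T) (x : T) (b : bool) : path e x p ->
  connect double_cover (x, b) (last x p, odd (size p) (+) b).
Proof.
elim: p x b => [|y p IHp] x b //= /andP[exy /(IHp _ (~~ b))].
rewrite addNb addbN; apply: connect_trans.
by apply: connect1; rewrite /double_cover /= exy eqxx.
Qed.

Lemma double_coverP (x y : T) (b c : bool) :
  reflect (exists p, [/\ path e x p, last x p = y & odd (size p) = b (+) c])
          (connect double_cover (x, b) (y, c)).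
Proof.
apply: (iffP idP) => [/connectP[q]|[p [xp <- op]]].
  elim: q x b => [|[z d] q IHq] x b /=.
    by move=> _ [-> ->]; exists [::]; split=> //; rewrite addbb.
  rewrite {1}/double_cover /= => /andP[/andP[exz /eqP->] zq] lastq.
  have [p [zp lastp oddp]] := IHq _ _ zq lastq.
  by exists (z :: p); split; rewrite /= ?exz // oddp addNb negbK.
by have := double_cover_path b xp; rewrite op addbC addKb.
Qed.

(** Writing parity as [odd n == b] lets concatenation of walks become addition modulo 2 on the
    labels. *)
Lemma walk_joined_cat (b c : bool) (x y z : T) :
  walk_joined e (fun n => odd n == b) x y ->
  walk_joined e (fun n => odd n == c) y z ->
  walk_joined e (fun n => odd n == b (+) c) x z.
Proof.
move=> [p [xp <- /eqP<-]] [q [yq <- /eqP<-]].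
by exists (p ++ q); rewrite cat_path xp last_cat size_cat oddD; split.
Qed.

Lemma walk_joined_sym (S : pred nat) (x y : T) : symmetric e ->
  walk_joined e S x y -> walk_joined e S y x.
Proof.
move=> e_sym [p [xp <- Sp]]; exists (rev (belast x p)).
rewrite size_rev size_belast; split=> //.
  by rewrite rev_path (eq_path (e' := e)).
by case: p {xp Sp} => //= z p; rewrite rev_cons last_rcons.
Qed.

Lemma bipartition_side (A B : {set T}) : is_bipartition e A B ->
  forall x, (x \in B) = (x \notin A).
Proof.
move=> [_ _ /setP AB dAB _] x; move: (AB x); rewrite !inE.
by case: (boolP (x \in A)) => // xA _; rewrite (disjointFr dAB).
Qed.

Lemma bipartition_sym (A B : {set T}) :
  is_bipartition e A B -> is_bipartition e B A.
Proof.
move=> [A0 B0 AB dAB eAB]; split; rewrite 1?setUC 1?disjoint_sym //.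
by move=> x y /eAB; rewrite orbC.
Qed.

Lemma bipartition_walk (A B : {set T}) (x : T) (p : seq T) :
  is_bipartition e A B -> path e x p ->
  (last x p \in A) = (x \in A) (+) odd (size p).
Proof.
move=> bAB; elim: p x => [|y p IHp] x /=; first by rewrite addbF.
case/andP=> exy /IHp->; rewrite addbN -addNb; congr (_ (+) _).
have [_ _ _ _ /(_ x y exy)] := bAB; rewrite !(bipartition_side bAB).
by case: (x \in A); case: (y \in A).
Qed.

(** The candidate sides are the vertices reached from [x] by even walks and by odd walks. A vertex
    in both would give an odd closed walk at [x], by going out along one walk and back along the
    other. An edge puts one endpoint in each side, so neither is empty. *)
Lemma bipartition_or_odd_closed_walk (x : T) : symmetric e -> has_edge e ->
  connected_graph e ->
  (exists A B, is_bipartition e A B) \/ walk_joined e odd x x.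
Proof.
move=> e_sym [u [v euv]] e_conn.
(* Connectivity in the finite double cover is decidable, so this case split needs no classical
   axiom. *)
have [/double_coverP[p []]|no_odd] :=
    boolP (connect double_cover (x, false) (x, true)).
  by right; exists p.
left; pose W b := [set y | connect double_cover (x, false) (y, b)].
have WP b y : reflect (walk_joined e (fun n => odd n == b) x y) (y \in W b).
  rewrite inE; apply: (iffP (double_coverP _ _ _ _)) => -[p [xp lp /eqP op]];
  by exists p; split=> //; apply/eqP.
have W_edge b y z : e y z -> y \in W b -> z \in W (~~ b).
  move=> eyz /WP xy; apply/WP; rewrite -addbT; apply: walk_joined_cat xy _.
  by exists [:: z]; rewrite /= eyz.
have W_cover y : y \in W false :|: W true.
  have [p xp ->] := connectP (e_conn x y).
  rewrite in_setU; case op: (odd (size p)); apply/orP; [right|left];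
  by apply/WP; exists p; rewrite op.
have W_dis : [disjoint W false & W true].
  apply/pred0P=> y /=; apply/negP=> /andP[/WP Ey /WP Oy].
  have /WP : walk_joined e (fun n => odd n == false (+) true) x x.
    exact: walk_joined_cat Ey (walk_joined_sym e_sym Oy).
  by rewrite inE (negPf no_odd).
have W_adj y z : e y z ->
    (y \in W false) && (z \in W true) || (y \in W true) && (z \in W false).
  move=> eyz; have := W_cover y; rewrite in_setU.
  by case/orP=> Wy; rewrite Wy (W_edge _ _ _ eyz Wy) ?orbT.
exists (W false), (W true); split=> //.
- by apply/set0Pn; case/orP: (W_adj u v euv) => /andP[]; [exists u|exists v].
- by apply/set0Pn; case/orP: (W_adj u v euv) => /andP[]; [exists v|exists u].
- by apply/setP=> y; rewrite W_cover inE.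
Qed.

Lemma odd_hamiltonian_side_le (A B : {set T}) (c : seq T) :
  is_bipartition e A B -> S_hamiltonian_cycle e odd c -> #|A| <= #|B|.
Proof.
move=> bAB [c_uniq c_all c_next].
rewrite -(card_imset (mem A) (can_inj (prev_next c_uniq))).
apply/subset_leq_card/subsetP=> _ /imsetP[x /= xA ->].
have [p [xp <- op]] := c_next x (c_all x).
by rewrite (bipartition_side bAB) (bipartition_walk bAB xp) op xA.
Qed.

(** A walk of even length is corrected by putting an odd closed walk at [x] in front of it. *)
Lemma odd_walk_total : symmetric e -> has_edge e -> connected_graph e ->
  ~ bipartite e -> forall x y, walk_joined e odd x y.
Proof.
move=> e_sym e_edge e_conn not_bip x y.
have [//|[q [xq lq oq]]] :=
    bipartition_or_odd_closed_walk x e_sym e_edge e_conn.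
have [p xp ->] := connectP (e_conn x y).
have [op|op] := boolP (odd (size p)); first by exists p.
exists (q ++ p); rewrite cat_path xq lq xp last_cat lq size_cat oddD oq.
by rewrite (negPf op).
Qed.

End Walks.

(** The vertex [y] plays the predecessor of the list; keeping it outside [A] is what carries the
    induction, as each step adds one entry of [s] and then one of [t]. *)
Lemma alternating_listing (T : eqType) (A : {pred T}) (s t : seq T) (y : T) :
  size s = size t -> all [in A] s -> all [predC A] t -> y \notin A ->
  exists c, [/\ perm_eq c (s ++ t),
    path (fun x z => (x \in A) != (z \in A)) y c & last y c \notin A].
Proof.
elim: s t y => [|a s IHs] [|b t] y //=; first by exists [::].
move=> [sz_st] /andP[aA sA] /andP[/= bA tA] yA.
have [c [pc bc lc]] := IHs _ _ sz_st sA tA bA.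
exists [:: a, b & c]; split=> //=; last by rewrite (negPf yA) (negPf bA) aA.
by rewrite perm_cons perm_sym -cat1s perm_catCA /= perm_cons perm_sym.
Qed.

Lemma alternating_cycle (T : finType) (A : {set T}) : #|A| = #|~: A| ->
  exists c, [/\ uniq c, forall x, x \in c &
    cycle (fun x z => (x \in A) != (z \in A)) c].
Proof.
move=> cardA; have [A0|[y]] := set_0Vmem (~: A).
  (* With an empty complement, equal cardinalities leave no vertex at all. *)
  exists [::]; split=> // x; move/eqP: cardA.
  by rewrite -[A]setCK A0 setC0 setCT cards0 cardsT => /eqP/card0_eq/(_ x).
rewrite inE => yA.
have [||||c [pc yc lc]] :=
    @alternating_listing T (mem A) (enum A) (enum (~: A)) y.
- by rewrite -!cardE.
- by apply/allP=> x; rewrite mem_enum.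
- by apply/allP=> x; rewrite mem_enum inE.
- by [].
exists c; split.
- rewrite (perm_uniq pc) cat_uniq !enum_uniq andbT; apply/hasPn=> x.
  by rewrite !mem_enum inE.
- by move=> x; rewrite (perm_mem pc) mem_cat !mem_enum inE orbN.
(* The last entry lies outside [A] just as [y] does, so the alternation from [y] to the head also
   closes the cycle. *)
case: c yc lc {pc} => //= a c /andP[ya ac] lc; rewrite rcons_path ac.
by move: ya; rewrite /= (negPf yA) (negPf lc).
Qed.

Theorem theorem16 (T : finType) (e : rel T)
    (e_sym : symmetric e) (e_irr : irreflexive e)
    (e_nonempty : has_edge e) (e_conn : connected_graph e) :
  (exists c : seq T, S_hamiltonian_cycle e odd c) <->
  (~ bipartite e \/
   exists A B : {set T}, is_bipartition e A B /\ #|A| = #|B|).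
Proof.
split=> [[c c_ham]|[not_bip|[A [B [bAB cardAB]]]]].
- have [x _] := e_nonempty.
  have [[A [B bAB]]|[p [xp lp op]]] :=
      bipartition_or_odd_closed_walk x e_sym e_nonempty e_conn.
    right; exists A, B; split=> //; apply/eqP; rewrite eqn_leq.
    rewrite (odd_hamiltonian_side_le bAB c_ham).
    exact: odd_hamiltonian_side_le (bipartition_sym bAB) c_ham.
  (* An odd closed walk would place [x] on the side opposite to its own. *)
  left=> -[A [B bAB]]; have := bipartition_walk bAB xp.
  by rewrite lp op; case: (x \in A).
- exists (enum T); split=> [|x|x _]; rewrite ?enum_uniq ?mem_enum //.
  exact: odd_walk_total.
have defB : B = ~: A by apply/setP=> x; rewrite inE (bipartition_side bAB).
have [|c [c_uniq c_all c_alt]] := @alternating_cycle T A.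
  by rewrite -defB.
exists c; split=> // x xc; have := next_cycle c_alt xc; move: (next c x) => y.
have [p xp ->] := connectP (e_conn x y).
rewrite (bipartition_walk bAB xp) => alt; exists p; split=> //.
by move: alt; case: (x \in A); case: odd.
Qed.
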